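(* For every integer $k\ge 3$, there exists a nonnegative function $f\in L^1(\mathbb{R})$ such that there are uncountably many nonnegative functions in $L^1(\mathbb{R})$, no two of which are translates of each other, that have the same $k$-deck as $f$.
   Context: For an integer $k\ge 3$ and a nonnegative $f\in L^1(\mathbb{R})$, the $k$-deck of $f$ is the function on $\mathbb{R}^{k-1}$ given by $N_f(x_1,\ldots,x_{k-1})=\int_{\mathbb{R}} f(t)f(t+x_1)\cdots f(t+x_{k-1})\,dt$. Two functions have the same $k$-deck if their $k$-decks are equal almost everywhere on $\mathbb{R}^{k-1}$. Functions $g,h$ are translates of each other if there is $a\in\mathbb{R}$ with $h(x)=g(x-a)$ for almost every $x$. *)

(* Defs.v *)
From HB Require Import structures.
From mathcomp Require Import all_boot all_order all_algebra.
From mathcomp Require Import all_classical all_reals all_analysis.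

Set Implicit Arguments.
Unset Strict Implicit.
Unset Printing Implicit Defensive.

Import Order.TTheory GRing.Theory Num.Theory.
Import numFieldNormedType.Exports.

Local Open Scope classical_set_scope.
Local Open Scope ring_scope.

Local Notation borelR R := (measurableTypeR R).

Definition tcons (T : Type) n (z : T * n.-tuple T) : n.+1.-tuple T :=
  [tuple of z.1 :: z.2].

(* Lebesgue measure on the Borel sets of R^n; its value on boxes is given by
   [lebesgue_tuple_box] below. *)
Fixpoint lebesgue_tuple (R : realType) (n : nat) :
    set (n.-tuple (borelR R)) -> \bar R :=
  match n with
  | 0 => \d_ (nil_tuple (borelR R))
  | n'.+1 => pushforward (lebesgue_measure \x @lebesgue_tuple R n')%E
               (@tcons (borelR R) n')
  end.

Section lebesgue_tuple_measure.
Context (R : realType).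
Local Open Scope ereal_scope.
Local Notation mu := (@lebesgue_measure R).

Definition tbox n (A : 'I_n -> set R) : set (n.-tuple (borelR R)) :=
  [set x | forall i, A i (tnth x i)].

Lemma measurable_tbox n (A : 'I_n -> set (borelR R)) :
  (forall i, measurable (A i)) -> measurable (tbox A).
Proof.
move=> mA; rewrite (_ : tbox A = \bigcap_(i in [set: 'I_n])
    ((fun x : n.-tuple (borelR R) => tnth x i) @^-1` A i)).
  apply: fin_bigcap_measurable => // i _; rewrite -[X in measurable X]setTI.
  exact: measurable_tnth.
by apply/seteqP; split => x /=; [move=> h i _; exact: h|move=> h i; exact: h].
Qed.

Lemma tcons_tbox n (A : 'I_n.+1 -> set R) :
  @tcons R n @^-1` tbox A = A ord0 `*` tbox (fun i => A (lift ord0 i)).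
Proof.
apply/seteqP; split => -[a x]; rewrite /tbox /tcons /=.
  by move=> h; split=> [|i]; [exact: (h ord0)|have := h (lift ord0 i); rewrite tnthS].
move=> [h0 h] i; case: (unliftP ord0 i) => [j|] ->; last exact: h0.
by rewrite tnthS; exact: h.
Qed.

Lemma measurable_tcons n : measurable_fun setT (@tcons (borelR R) n).
Proof. exact: measurable_cons. Qed.

Lemma box_sigma_finite n (m : set (n.-tuple (borelR R)) -> \bar R) :
  (forall A : 'I_n -> set (borelR R), (forall i, measurable (A i)) ->
    m (tbox A) = \prod_(i < n) mu (A i)) ->
  sigma_finite setT m.
Proof.
move=> mE; pose I (j : nat) : set R := `[(- j%:R)%R, (j%:R)%R]%classic.
exists (fun j => tbox (fun=> I j)) => [|j]; last first.
  split; first by apply: measurable_tbox => i; exact: measurable_itv.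
  rewrite mE; last by move=> i; exact: measurable_itv.
  rewrite ltey_eq; apply/orP; left.
  apply: (big_ind (fun y => y \is a fin_num)) => // [|i _]; first exact: fin_numM.
  by rewrite /I lebesgue_measure_itv/=; case: ifP => // _; rewrite -EFinD.
apply/esym/seteqP; split=> // x _.
exists (\sum_(i < n) (Num.truncn `|tnth x i|%R).+1)%N => //= i.
rewrite /I /= in_itv /= -ler_norml.
apply: (@le_trans _ _ ((Num.truncn `|tnth x i|).+1%:R)%R); first exact/ltW/truncnS_gt.
by rewrite ler_nat (bigD1 i)//= leq_addr.
Qed.

Lemma lebesgue_tuple_spec n :
  exists2 m : {sigma_finite_measure set (n.-tuple (borelR R)) -> \bar R},
    lebesgue_tuple (n := n) = m :> (set _ -> \bar R) &
    forall A : 'I_n -> set (borelR R), (forall i, measurable (A i)) ->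
      m (tbox A) = \prod_(i < n) mu (A i).
Proof.
have H n' (m : {measure set (n'.-tuple (borelR R)) -> \bar R}) :
    lebesgue_tuple (n := n') = m :> (set _ -> \bar R) ->
    (forall A : 'I_n' -> set (borelR R), (forall i, measurable (A i)) ->
      m (tbox A) = \prod_(i < n') mu (A i)) ->
  exists2 m : {sigma_finite_measure set (n'.-tuple (borelR R)) -> \bar R},
    lebesgue_tuple (n := n') = m :> (set _ -> \bar R) &
    forall A : 'I_n' -> set (borelR R), (forall i, measurable (A i)) ->
      m (tbox A) = \prod_(i < n') mu (A i).
  move=> mE Hm; have sf := box_sigma_finite Hm.
  case: m mE Hm sf => m [c1 c2] /= mE Hm sf.
  pose m0 : {measure set (n'.-tuple (borelR R)) -> \bar R} :=
    @Measure.Pack _ _ _ m (@Measure.Class _ _ _ m c1 c2).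
  pose X := @isSFinite.Build _ _ _ m (@sfinite_measure_sigma_finite _ _ _ m0 sf).
  pose Y := @isSigmaFinite.Build _ _ _ m sf.
  pose m' : {sigma_finite_measure set (n'.-tuple (borelR R)) -> \bar R} :=
    HB.pack m c1 c2 X Y.
  by exists m'.
elim: n => [|n [m mE mbox]].
  apply: (H _ (\d_ (nil_tuple (borelR R)))) => //= A _.
  by rewrite big_ord0 diracE mem_set// => -[].
pose P : {measure set (n.+1.-tuple (borelR R)) -> \bar R} :=
  measure_function_pushforward__canonical__measure_function_Measure
    (mu \x m) (@measurable_tcons n).
apply: (H _ P) => [|A mA]; first by rewrite /= mE.
rewrite /P/= /pushforward tcons_tbox product_measure1E//; last exact: measurable_tbox.
by rewrite mbox// big_ord_recl.
Qed.

Lemma lebesgue_tuple_box n (A : 'I_n -> set (borelR R)) :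
  (forall i, measurable (A i)) ->
  lebesgue_tuple (tbox A) = \prod_(i < n) mu (A i).
Proof. by case: (lebesgue_tuple_spec n) => m -> +; exact. Qed.

Let lebesgue_tuple0 n : lebesgue_tuple (n := n) set0 = 0 :> \bar R.
Proof. by case: (lebesgue_tuple_spec n) => m -> _; exact: measure0. Qed.

Let lebesgue_tuple_ge0 n A : 0 <= lebesgue_tuple (n := n) A :> \bar R.
Proof. by case: (lebesgue_tuple_spec n) => m -> _; exact: measure_ge0. Qed.

Let lebesgue_tuple_sigma_additive n :
  semi_sigma_additive (@lebesgue_tuple R n).
Proof.
case: (lebesgue_tuple_spec n) => m -> _.
exact: measure_semi_sigma_additive.
Qed.

HB.instance Definition _ n := isMeasure.Build _ _ _ (@lebesgue_tuple R n)
  (lebesgue_tuple0 n) (@lebesgue_tuple_ge0 n)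
  (@lebesgue_tuple_sigma_additive n).

Let lebesgue_tuple_sigma_finite n : sigma_finite setT (@lebesgue_tuple R n).
Proof. by apply: box_sigma_finite => A; exact: lebesgue_tuple_box. Qed.

HB.instance Definition _ n := @Measure_isSigmaFinite.Build _ _ _
  (@lebesgue_tuple R n) (lebesgue_tuple_sigma_finite n).

End lebesgue_tuple_measure.

Local Notation mu R := (@lebesgue_measure R).

(* A Borel representative of an element of L^1(R), taken nonnegative
   everywhere. *)
Definition nonneg_L1 (R : realType) (f : R -> R) : Prop :=
  (mu R).-integrable setT (EFin \o f) /\ (forall t, 0 <= f t).

(* For f >= 0 in L^1 this integral may be +oo, though only for x in a
   Lebesgue-null set, hence the codomain. *)
Definition kdeck (R : realType) (k : nat) (f : R -> R)
    (x : k.-1.-tuple (borelR R)) : \bar R :=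
  (\int[mu R]_t (f t * \prod_(i < k.-1) f (t + tnth x i))%:E)%E.

Definition same_kdeck (R : realType) (k : nat) (f g : R -> R) : Prop :=
  {ae @lebesgue_tuple R k.-1, forall x, kdeck f x = kdeck g x}.

Definition translates (R : realType) (g h : R -> R) : Prop :=
  exists a : R, {ae mu R, forall x, h x = g (x - a)}.

(* Main.v *)
Require Import Defs.
From mathcomp Require Import all_boot all_order all_algebra.
From mathcomp Require Import all_classical all_reals all_analysis.
From mathcomp Require Import measurable_realfun ring lra.

(** Let [phi t = (sin t / t) ^ 2], whose Fourier transform is supported in
    [[-2, 2]], and let [g_th t = phi t * (1 + cos (L * t + th))] with
    [L = 2 * k + 1]. Expanding the [k] cosine factors in the [k]-deck of [g_th]
    gives terms [\int Phi(t) * cos (m * (L * t + th) + d) dt], where [Phi] is a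
    product of [k] translates of [phi], hence of bandwidth [2 * k < L]. The
    terms with [m != 0] vanish and those with [m = 0] do not involve [th], so
    the deck is the same for all [th]. No Fourier transform is needed: being
    bandlimited is expressed by a decay rate, uniform over all higher
    frequencies, of the integrals against [cos (w * t + c)] cut off at scale
    [N]; this passes to pointwise limits, in particular from the partial
    products to the limit in Viete's formula
    [sin t / t = \prod_j cos (t / 2 ^ j)]. Finally
    [t ^ 2 * g_th t = sin t ^ 2 * (1 + cos (L * t + th))] is periodic,
    which excludes nontrivial translations within the family. *)

Set Implicit Arguments.
Unset Strict Implicit.
Unset Printing Implicit Defensive.

Import Order.TTheory GRing.Theory Num.Theory.
Import numFieldNormedType.Exports.

Local Open Scope classical_set_scope.
Local Open Scope ring_scope.

Section deck_invariance.
Context {R : realType}.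
Local Notation mu := (@lebesgue_measure R).
Implicit Types (F f g : R -> R).

(** * Integrability and dominated convergence for real-valued integrals *)

Lemma integrableM_bounded f g (M : R) :
  mu.-integrable setT (EFin \o f) -> measurable_fun setT g ->
  (forall t, `|g t| <= M) -> mu.-integrable setT (EFin \o (f \* g)).
Proof.
move=> intf mg gM.
rewrite (_ : EFin \o _ = (EFin \o f) \* (EFin \o g))%E//.
apply: integrableMl => //.
by exists M; split => [|y My t _] /=; [exact: num_real|exact/(le_trans (gM t))/ltW].
Qed.

Lemma Rintegral_dominated_cvg (f_ : (R -> R)^nat) f g :
  (forall n, measurable_fun setT (f_ n)) ->
  (forall t, f_ ^~ t @ \oo --> f t) ->
  mu.-integrable setT (EFin \o g) -> (forall n t, `|f_ n t| <= g t) ->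
  \int[mu]_t f_ n t @[n --> \oo] --> \int[mu]_t f t.
Proof.
move=> mf_ f_f intg f_g.
have mf : measurable_fun setT f.
  by apply: (measurable_fun_cvg (h := f_)) => // t _; exact: f_f.
have mEf_ n : measurable_fun setT (EFin \o f_ n) by exact/measurable_EFinP.
have mEf : measurable_fun setT (EFin \o f) by exact/measurable_EFinP.
have cvgE : {ae mu, forall t, setT t ->
    (EFin \o f_ n) t @[n --> \oo] --> (EFin \o f) t}%E.
  by apply: aeW => t _; apply: cvg_EFin; [exact: nearW|exact: f_f].
have leE : {ae mu, forall t n, setT t ->
    (`|(EFin \o f_ n) t| <= (EFin \o g) t)%E}.
  by apply: aeW => t n _; rewrite lee_fin f_g.
have [intf _ cvgf] :=
  @dominated_convergence _ _ _ mu setT measurableT _ _ _ mEf_ mEf cvgE intg leE.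
apply: fine_cvg; rewrite fineK//.
by rewrite (integrable_fin_num _ intf).
Qed.

(** * A parabolic cutoff and its integrals against cosines *)

Lemma continuous_parabola (N : R) : continuous (fun t : R => 1 - (t / N) ^+ 2).
Proof.
move=> t; apply: cvgB; first exact: cvg_cst.
apply: (@continuous_comp _ _ _ (fun t : R => t / N) (fun y => y ^+ 2)).
  exact: mulrr_continuous.
exact: exprn_continuous.
Qed.

Lemma continuous_cos_affine (w c : R) : continuous (fun t : R => cos (w * t + c)).
Proof.
move=> t; apply: continuous_comp; last exact: continuous_cos.
apply: cvgD; last exact: cvg_cst.
by apply: cvgM; [exact: cvg_cst|exact: cvg_id].
Qed.

(** Obtained by integrating by parts until the parabola is used up. The first term vanishes at [N]
    and [- N], so only boundary values of order [1 / N] remain. *)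
Definition parabola_cos_primitive (N w c t : R) := (1 - (t / N) ^+ 2) * (sin (w * t + c) / w)
  - 2 * t / (N ^+ 2 * w ^+ 2) * cos (w * t + c)
  + 2 / (N ^+ 2 * w ^+ 3) * sin (w * t + c).

Lemma is_derive_parabola_cos_primitive (N w c t : R) : 0 < N -> 0 < w ->
  is_derive t 1 (parabola_cos_primitive N w c) ((1 - (t / N) ^+ 2) * cos (w * t + c)).
Proof.
move=> N0 w0.
have N0' : N != 0 by rewrite gt_eqF.
have w0' : w != 0 by rewrite gt_eqF.
apply: is_derive_eq.
rewrite /= !(scaler0, addr0, add0r, sub0r, mul0r) /GRing.scale /=.
set s := sin _; set k := cos _; field.
by rewrite N0' w0'.
Qed.

Lemma integral_parabola_cos (N w c : R) : 1 <= N -> 1 <= w ->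
  `|\int[mu]_(t in `[- N, N]) ((1 - (t / N) ^+ 2) * cos (w * t + c))| <= 8 / N.
Proof.
move=> N1 w1; have N0 : 0 < N by lra.
have w0 : 0 < w by lra.
have dF t := is_derive_parabola_cos_primitive c t N0 w0.
have cF : continuous (parabola_cos_primitive N w c).
  by move=> t; have [/derivable1_diffP/differentiable_continuous] := dF t.
rewrite /Rintegral (@continuous_FTC2 _ _ (parabola_cos_primitive N w c)); last 4 first.
- lra.
- apply: continuous_subspaceT => t.
  by apply: cvgM; [exact: continuous_parabola|exact: continuous_cos_affine].
- split=> [t _||].
  + exact: ex_derive.
  + exact/cvg_at_right_filter/cF.
  + exact/cvg_at_left_filter/cF.
- by move=> t _; rewrite derive1E; apply: derive_val.
rewrite -EFinB /= /parabola_cos_primitive !mulNr divff ?gt_eqF// sqrrN expr1n subrr !mul0r.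
rewrite !add0r.
(* [M] and [v] stand for [1 / N] and [1 / w]. Each of the four boundary terms is at most [2 * M],
   whence the constant 8. *)
have bound (C S C' S' M v : R) : `|C| <= 1 -> `|S| <= 1 -> `|C'| <= 1 ->
    `|S'| <= 1 -> 0 <= M <= 1 -> 0 <= v <= 1 ->
  `|- (2 * M * v ^+ 2 * C) + 2 * M ^+ 2 * v ^+ 3 * S -
    (2 * M * v ^+ 2 * C' + 2 * M ^+ 2 * v ^+ 3 * S')| <= 8 * M.
  move=> C1 S1 C'1 S'1 /andP[M0 M1] /andP[v0 v1].
  have A0 : 0 <= 2 * M * v ^+ 2 by rewrite !mulr_ge0 ?sqr_ge0.
  have A1 : 2 * M * v ^+ 2 <= 2 * M.
    by rewrite ler_piMr ?mulr_ge0 ?exprn_ile1.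
  have B0 : 0 <= 2 * M ^+ 2 * v ^+ 3 by rewrite !mulr_ge0 ?exprn_ge0.
  have B1 : 2 * M ^+ 2 * v ^+ 3 <= 2 * M.
    rewrite -mulrA ler_pM2l// expr2 -mulrA ler_piMr//.
    by rewrite mulr_ile1 ?exprn_ge0 ?exprn_ile1.
  have P (A x : R) : 0 <= A -> A <= 2 * M -> `|x| <= 1 -> `|A * x| <= 2 * M.
    by move=> A_ge0 A_le x1; rewrite normrM ger0_norm// (le_trans _ A_le)// ler_piMr.
  move: (P _ _ A0 A1 C1) (P _ _ A0 A1 C'1) (P _ _ B0 B1 S1) (P _ _ B0 B1 S'1).
  rewrite !ler_norml; lra.
have inv_le1 (x : R) : 1 <= x -> 0 <= x^-1 <= 1.
  by move=> x1; rewrite invr_ge0 invf_le1; lra.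
have := bound _ _ _ _ _ _ (cos_max (w * N + c)) (sin_max (w * N + c))
  (cos_max (w * - N + c)) (sin_max (w * - N + c)) (inv_le1 _ N1) (inv_le1 _ w1).
congr (`|_| <= _); rewrite !mulrN; move: (cos _) (sin _) (cos _) (sin _).
move=> C S C' S'; field; rewrite !gt_eqF//.
Qed.

(** A sharp cutoff would leave boundary terms of size [1 / w], which do not decay in the scale; the
    parabola is zero at both ends and still has an elementary primitive against cosines. *)
Definition cutoff n (t : R) : R := Num.max 0 (1 - (t / n.+1%:R) ^+ 2).

Lemma cutoff_ge0 n t : 0 <= cutoff n t.
Proof. by rewrite le_max lexx. Qed.

Lemma cutoff_le1 n t : cutoff n t <= 1.
Proof. by rewrite ge_max ler01/= gerBl sqr_ge0. Qed.

Lemma cutoffE n : cutoff n =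
  (fun t : R => 1 - (t / n.+1%:R) ^+ 2) \_ `[- n.+1%:R, n.+1%:R].
Proof.
apply/funext => t; rewrite patchE mem_setE in_itv/= -ler_norml /cutoff.
have -> : (`|t| <= n.+1%:R) = (0 <= 1 - (t / n.+1%:R) ^+ 2).
  rewrite subr_ge0 -(real_normK (num_real (t / _))) expr_le1//.
  by rewrite normf_div (ger0_norm (ler0n _ _)) ler_pdivrMr// mul1r.
by case: ifPn => [/max_idPr//|]; rewrite -ltNge => /ltW/max_idPl.
Qed.

Lemma integrable_cutoff n : mu.-integrable setT (EFin \o cutoff n).
Proof.
rewrite cutoffE -restrict_EFin; apply/integrable_restrict => //=.
rewrite setTI; apply: continuous_compact_integrable; first exact: segment_compact.
exact/continuous_subspaceT/continuous_parabola.
Qed.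

Lemma integral_cutoff_cos n (w c : R) : 1 <= w ->
  `|\int[mu]_t (cutoff n t * cos (w * t + c))| <= 8 / n.+1%:R.
Proof.
move=> w1; rewrite (_ : \int[mu]_t _ = \int[mu]_(t in `[- n.+1%:R, n.+1%:R])
    ((1 - (t / n.+1%:R) ^+ 2) * cos (w * t + c))).
  by apply: integral_parabola_cos => //; rewrite ler1n.
rewrite [RHS]Rintegral_mkcond; apply: eq_Rintegral => t _.
by rewrite cutoffE !patchE; case: ifP => //; rewrite mul0r.
Qed.

Lemma cvg_cutoff t : cutoff n t @[n --> \oo] --> (1 : R).
Proof.
have cvg0 : (1 - (t / n.+1%:R) ^+ 2) @[n --> \oo] --> (1 : R).
  rewrite -[X in _ --> X]subr0; apply: cvgB; first exact: cvg_cst.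
  have cvg0 : t / n.+1%:R @[n --> \oo] --> t * 0.
    by apply: cvgM; [exact: cvg_cst|exact: cvg_harmonic].
  rewrite (_ : 0 = (t * 0) * (t * 0)); last by rewrite !mulr0.
  exact: (cvgM cvg0 cvg0).
rewrite -(_ : Num.max 0 1 = 1 :> R); last exact/max_idPr.
have cmax : {for 1, continuous (fun y : R => Num.max 0 y)}.
  by apply: (@continuous_max _ _ (cst 0) id) => //; exact: cvg_cst.
exact: (continuous_cvg _ cmax cvg0).
Qed.

(** * Bandlimited functions without the Fourier transform *)

(* The constant 8 must not depend on [F], so that the condition survives
   pointwise limits. *)
Definition bandlimited (s : R) F :=
  [/\ measurable_fun setT F, forall t, `|F t| <= 1 &
    forall n w c, s + 1 <= w ->
      `|\int[mu]_t (cutoff n t * (F t * cos (w * t + c)))| <= 8 / n.+1%:R].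

Lemma bandlimited1 : bandlimited 0 (cst 1).
Proof.
split=> [||n w c]; first exact: measurable_cst.
  by move=> t; rewrite normr1.
rewrite add0r => w1; under eq_Rintegral do rewrite mul1r.
exact: integral_cutoff_cos.
Qed.

Lemma measurable_cos_affine (w c : R) :
  measurable_fun setT (fun t : R => cos (w * t + c)).
Proof. by apply: continuous_measurable_fun; exact: continuous_cos_affine. Qed.

Lemma integrable_bandlimited_test n F w c : measurable_fun setT F ->
  (forall t, `|F t| <= 1) ->
  mu.-integrable setT
    (EFin \o (fun t => cutoff n t * (F t * cos (w * t + c)))).
Proof.
move=> mF F1; apply: (@integrableM_bounded _ _ 1).
- exact: integrable_cutoff.
- by apply: measurable_funM => //; exact: measurable_cos_affine.
- by move=> t; rewrite normrM mulr_ile1// cos_max.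
Qed.

Lemma cos_mul_cos (x y : R) : cos x * cos y = 2^-1 * cos (y + x) + 2^-1 * cos (y - x).
Proof. by rewrite cosD cosB; lra. Qed.

(** Product-to-sum moves the test frequency from [w] to [w + b] and [w - b], both still at least
    [s + 1]. The two weights 1/2 average the bounds, so the constant 8 is kept. *)
Lemma bandlimited_cos s F b d : bandlimited s F ->
  bandlimited (s + `|b|) (fun t => F t * cos (b * t + d)).
Proof.
move=> [mF F1 FE]; split.
- by apply: measurable_funM => //; exact: measurable_cos_affine.
- by move=> t; rewrite normrM mulr_ile1// cos_max.
move=> n w c ws.
have split_cos t : cutoff n t * (F t * cos (b * t + d) * cos (w * t + c)) =
    2^-1 * (cutoff n t * (F t * cos ((w + b) * t + (c + d)))) +
    2^-1 * (cutoff n t * (F t * cos ((w - b) * t + (c - d)))).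
  rewrite -(mulrA (F t)) cos_mul_cos.
  rewrite (_ : _ + c + _ = (w + b) * t + (c + d)); last by ring.
  rewrite (_ : _ + c - _ = (w - b) * t + (c - d)); last by ring.
  by ring.
under eq_Rintegral do rewrite split_cos.
have int w' c' : mu.-integrable setT (EFin \o (fun t =>
    2^-1 * (cutoff n t * (F t * cos (w' * t + c'))))).
  have := @integrableZl _ _ _ mu setT measurableT 2^-1 _
    (integrable_bandlimited_test n w' c' mF F1).
  exact.
rewrite RintegralD// !RintegralZl//; try exact: integrable_bandlimited_test.
have := FE n (w + b) (c + d); have := FE n (w - b) (c - d).
have b1 := ler_norm b; have b2 := ler_norm (- b); rewrite normrN in b2.
have wb1 : s + 1 <= w + b by lra.
have wb2 : s + 1 <= w - b by lra.
move=> /(_ wb2) + /(_ wb1).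
move: (Rintegral _ _ _) (Rintegral _ _ _) (8 / _) => I J M.
rewrite !ler_norml; lra.
Qed.

Lemma bandlimited_le s s' F : s <= s' -> bandlimited s F -> bandlimited s' F.
Proof.
by move=> ss' [mF F1 FE]; split => // n w c s'w; apply: FE; lra.
Qed.

(** At a fixed scale [n] the function [cutoff n] is an integrable majorant, whether or not the
    [F_ j] are integrable, and the bound to be passed to the limit is the same for all [j]. *)
Lemma bandlimited_cvg s (F_ : (R -> R)^nat) F :
  (forall j, bandlimited s (F_ j)) -> (forall t, F_ ^~ t @ \oo --> F t) ->
  bandlimited s F.
Proof.
move=> bF FF.
have mF : measurable_fun setT F.
  by apply: (measurable_fun_cvg (h := F_)) => // m; have [] := bF m.
have F1 t : `|F t| <= 1.
  rewrite -(cvg_lim _ (cvg_norm (FF t)))//; apply: limr_le.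
    by apply/cvg_ex; eexists; exact: cvg_norm (FF t).
  by apply: nearW => j; have [_ ] := bF j.
split => // n w c sw.
have cvgI : \int[mu]_t (cutoff n t * (F_ j t * cos (w * t + c))) @[j --> \oo]
    --> \int[mu]_t (cutoff n t * (F t * cos (w * t + c))).
  apply: (Rintegral_dominated_cvg _ _ (integrable_cutoff n)) => [j|t|j t].
  - have [mFj Fj1 _] := bF j.
    apply/measurable_EFinP.
    exact: measurable_int (integrable_bandlimited_test n w c mFj Fj1).
  - by apply: cvgM; [exact: cvg_cst|apply: cvgM; [exact: FF|exact: cvg_cst]].
  - have [_ Fj1 _] := bF j.
    rewrite normrM ger0_norm ?cutoff_ge0// ler_piMr ?cutoff_ge0//.
    by rewrite normrM mulr_ile1// cos_max.
apply: (cvgr_to_le (cvg_norm cvgI)); apply: nearW => j.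
by have [_ _] := bF j; apply.
Qed.

(** Let the cutoff scale tend to infinity: the integrals converge by domination by [|F|], while
    their bounds [8 / n.+1] tend to 0. *)
Lemma bandlimited_integral s F w c : bandlimited s F ->
  mu.-integrable setT (EFin \o F) -> s + 1 <= w ->
  \int[mu]_t (F t * cos (w * t + c)) = 0.
Proof.
move=> [mF F1 FE] intF sw.
have cvgI : \int[mu]_t (cutoff n t * (F t * cos (w * t + c))) @[n --> \oo]
    --> \int[mu]_t (F t * cos (w * t + c)).
  apply: (Rintegral_dominated_cvg (g := fun t => `|F t|)) => [n|t||n t].
  - apply/measurable_EFinP.
    exact: measurable_int (integrable_bandlimited_test n w c mF F1).
  - rewrite -[X in _ --> X]mul1r.
    by apply: cvgM; [exact: cvg_cutoff|exact: cvg_cst].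
  - exact: integrable_norm.
  - rewrite normrM (ger0_norm (cutoff_ge0 n t)) -[leRHS]mul1r.
    by rewrite ler_pM ?cutoff_ge0 ?cutoff_le1// normrM ler_piMr// cos_max.
have cvg0 : \int[mu]_t (cutoff n t * (F t * cos (w * t + c))) @[n --> \oo]
    --> (0 : R).
  apply: norm_cvg0; apply: (@squeeze_cvgr _ _ _ _ (cst 0) (fun n => 8 / n.+1%:R)).
  - by apply: nearW => n /=; rewrite normr_ge0 FE.
  - exact: cvg_cst.
  - rewrite -[X in _ --> X](mulr0 (8 : R)).
    by apply: cvgM; [exact: cvg_cst|exact: cvg_harmonic].
exact: cvg_unique cvgI cvg0.
Qed.

(** * The function [sinc]: Viete's product, bandwidth and integrability of its square *)

Definition sinc (t : R) : R := if t == 0 then 1 else sin t / t.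

Lemma sincM t : sinc t * t = sin t.
Proof.
by rewrite /sinc; case: eqP => [->|/eqP t0]; rewrite ?sin0 ?mulr0// divfK.
Qed.

(** The double-angle formula for the sine, iterated [n] times. *)
Lemma sin_viete n (t : R) :
  sin t = 2 ^+ n * sin (t / 2 ^+ n) * \prod_(j < n) cos (t / 2 ^+ j.+1).
Proof.
elim: n => [|n ->]; first by rewrite big_ord0 expr0 divr1 mul1r mulr1.
rewrite big_ord_recr/= (_ : t / 2 ^+ n = (t / 2 ^+ n.+1) *+ 2); last first.
  rewrite -mulr_natr exprS; field; by rewrite expf_neq0.
by rewrite sin_mulr2n exprS -mulr_natr; ring.
Qed.

Lemma cvg_sin_div (h : R^nat) : h @ \oo --> 0 -> (forall n, h n != 0) ->
  sin (h n) / h n @[n --> \oo] --> (1 : R).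
Proof.
move=> h0 hn0; have [dsin dsinE] := is_derive_sin (0 : R).
rewrite cos0 in dsinE.
have dcvg : (fun y => y^-1 *: (sin (y *: 1 + 0) - sin 0)) @ (0 : R)^' --> (1 : R).
  by rewrite -[X in _ --> X]dsinE; exact: dsin.
have hcvg : h @ \oo --> (0 : R)^'.
  move=> A A0; have : \forall n \near \oo, h n != 0 -> A (h n) by exact: h0 A0.
  by apply: filterS => n; apply; exact: hn0.
have := cvg_comp _ _ hcvg dcvg; apply: cvg_trans; apply: near_eq_cvg.
by apply: nearW => n /=; rewrite sin0 subr0 addr0 [_ *: 1]mulr1 mulrC.
Qed.

Lemma cvg_viete t :
  \prod_(j < n) cos (t / 2 ^+ j.+1) @[n --> \oo] --> sinc t.
Proof.
rewrite /sinc; case: eqP => [->|/eqP t0].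
  rewrite (_ : (fun n => _) = cst 1); first exact: cvg_cst.
  by apply/funext => n; rewrite big1// => j _; rewrite mul0r cos0.
pose h n : R := t / 2 ^+ n.
have hn0 n : h n != 0 by rewrite mulf_neq0 ?invr_eq0 ?expf_neq0.
have h0 : h @ \oo --> 0.
  rewrite -(mulr0 t); apply: cvgM; first exact: cvg_cst.
  rewrite (_ : (fun n => _) = (fun n => (2^-1 : R) ^+ n)); last first.
    by apply/funext => n; rewrite exprVn.
  by apply: cvg_expr; rewrite ger0_norm; lra.
have hcvg := cvg_sin_div h0 hn0.
have lim : (sin t / t) / (sin (h n) / h n) @[n --> \oo] --> sin t / t.
  rewrite -[X in _ --> X]divr1; apply: cvgM; first exact: cvg_cst.
  exact: cvgV.
apply: cvg_trans lim; apply: near_eq_cvg.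
(* The quotient in [lim] equals the partial product only where [sin (h n)] is nonzero, which holds
   eventually. *)
have : \forall n \near \oo, 0 < sin (h n) / h n by exact: cvgr_gt hcvg _ ltr01.
apply: filterS => n; case: (eqVneq (sin (h n)) 0) => [->|sn0 _].
  by rewrite mul0r ltxx.
rewrite (sin_viete n t) -/(h n) {3}/h.
have N0 : (2 : R) ^+ n != 0 by rewrite expf_neq0.
by field; rewrite t0 N0 sn0.
Qed.

(** The cosine factors of Viete's product have frequencies 1/2, 1/4, 1/8 and so on. These sum to
    [1 - 2 ^- n < 1], so all partial products share the bandwidth [s + 1], and so does their
    limit. *)
Lemma bandlimited_sinc (s : R) F x : bandlimited s F ->
  bandlimited (s + 1) (fun t => F t * sinc (t + x)).
Proof.
move=> bF; apply: (bandlimited_cvg (F_ := fun n t =>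
    F t * \prod_(j < n) cos ((t + x) / 2 ^+ j.+1))); last first.
  by move=> t; apply: cvgM; [exact: cvg_cst|exact: cvg_viete].
move=> n.
suff : bandlimited (s + (1 - 2 ^- n))
    (fun t => F t * \prod_(j < n) cos ((t + x) / 2 ^+ j.+1)).
  by apply: bandlimited_le; rewrite lerD2l gerBl invr_ge0 exprn_ge0.
elim: n => [|n IHn].
  rewrite expr0 invr1 subrr addr0 (_ : (fun t => _) = F)//.
  by apply/funext => t; rewrite big_ord0 mulr1.
have /(_ (2 ^- n.+1) (2 ^- n.+1 * x)) := bandlimited_cos _ _ IHn.
rewrite ger0_norm ?invr_ge0 ?exprn_ge0//.
rewrite (_ : s + _ + _ = s + (1 - 2 ^- n.+1)); last first.
  by rewrite exprS; field; rewrite expf_neq0.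
congr bandlimited; apply/funext => t.
by rewrite big_ord_recr/= mulrA -mulrDr [_ * (t + x)]mulrC.
Qed.

Lemma bandlimited_prod_sinc (s : R) F (xs : seq R) : bandlimited s F ->
  bandlimited (s + (size xs)%:R *+ 2)
    (fun t => F t * \prod_(x <- xs) sinc (t + x) ^+ 2).
Proof.
elim: xs s F => [|x xs IH] s F bF /=.
  rewrite mul0rn addr0 (_ : (fun t => _) = F)//.
  by apply/funext => t; rewrite big_nil mulr1.
have := IH _ _ (bandlimited_sinc x (bandlimited_sinc x bF)).
rewrite (_ : s + 1 + 1 + _ = s + (size xs).+1%:R *+ 2); last first.
  by rewrite -natr1; ring.
congr bandlimited; apply/funext => t.
by rewrite big_cons expr2 !mulrA.
Qed.

(** Measurability, and the bound in [sinc_max], are components of [bandlimited], so they are read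
    off from the product of [sinc] with the constant 1. *)
Lemma measurable_sinc : measurable_fun setT sinc.
Proof.
have := bandlimited_sinc 0 bandlimited1; case=> + _ _.
by rewrite (_ : (fun t => _) = sinc)//; apply/funext => t; rewrite mul1r addr0.
Qed.

Lemma sinc_max t : `|sinc t| <= 1.
Proof.
by have [_ /(_ t)] := bandlimited_sinc 0 bandlimited1; rewrite mul1r addr0.
Qed.

Lemma integrable_oneDsqrV : mu.-integrable setT (EFin \o (fun t : R => (oneDsqr t)^-1)).
Proof.
have cV := @continuous_oneDsqrV R.
apply/integrableP; split.
  by apply/measurable_EFinP; apply: continuous_measurable_fun.
under eq_integral do rewrite /= ger0_norm ?invr_ge0 ?(le_trans ler01 (oneDsqr_ge1 _))//.
rewrite (ge0_symfun_integralT _ cV); last 2 first.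
- by move=> t; rewrite invr_ge0 (le_trans ler01 (oneDsqr_ge1 _)).
- by move=> t; rewrite /= /oneDsqr sqrrN.
rewrite (_ : [set t | _] = `[0, +oo[%classic); last first.
  by apply/seteqP; split => t /=; rewrite in_itv/= andbT.
by rewrite integral0y_oneDsqr -EFinM ltry.
Qed.

(** Add [sinc t ^ 2 <= 1] and [(sinc t * t) ^ 2 = sin t ^ 2 <= 1]. *)
Lemma sinc_sqr_le t : sinc t ^+ 2 <= 2 * (oneDsqr t)^-1.
Proof.
rewrite -/(2 / oneDsqr t) ler_pdivlMr ?(lt_le_trans ltr01 (oneDsqr_ge1 _))//.
rewrite /oneDsqr mulrDr mulr1 -exprMn sincM.
have := sin_max t; have := sinc_max t.
rewrite -[in X in X -> _](@expr_le1 _ 2)// -[in X in _ -> X -> _](@expr_le1 _ 2)//.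
rewrite !real_normK ?num_real//; lra.
Qed.

Lemma integrable_sinc_sqr : mu.-integrable setT (EFin \o (fun t => sinc t ^+ 2)).
Proof.
have := @integrableZl _ _ _ mu setT measurableT 2 _ integrable_oneDsqrV.
apply: le_integrable => //.
  by apply/measurable_EFinP; apply: measurable_funX; exact: measurable_sinc.
move=> t _ /=; rewrite lee_fin ger0_norm ?sqr_ge0//.
by rewrite (le_trans (sinc_sqr_le t))// ler_norm.
Qed.

(** * Phase independence of integrals of cosine products *)

(** The leading cosine accumulates the factors expanded so far: [m] is the harmonic reached and [d]
    the phase shift collected. Decks correspond to [m = 0] and [d = 0]. *)
Definition harmonic_prod (L th : R) (m : int) (d : R) (cs : seq R) (t : R) : R :=
  cos (m%:~R * (L * t + th) + d) * \prod_(c <- cs) (1 + cos (L * t + th + c)).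

Section phase.
Variables (F : R -> R) (s L : R).
Hypotheses (intF : mu.-integrable setT (EFin \o F)) (bF : bandlimited s F).
Hypotheses (s_ge0 : 0 <= s) (sL : s + 1 <= L).

Lemma measurable_harmonic_prod th m d cs :
  measurable_fun setT (harmonic_prod L th m d cs).
Proof.
apply: measurable_funM.
  rewrite (_ : (fun t => _) =
      (fun t => cos (m%:~R * L * t + (m%:~R * th + d)))); last first.
    by apply/funext => t; congr cos; ring.
  exact: measurable_cos_affine.
apply: measurable_prod => c _; apply: measurable_funD; first exact: measurable_cst.
rewrite (_ : (fun t => _) = (fun t => cos (L * t + (th + c)))); last first.
  by apply/funext => t; rewrite addrA.
exact: measurable_cos_affine.
Qed.

Lemma harmonic_prod_max th m d cs t :
  `|harmonic_prod L th m d cs t| <= 2 ^+ size cs.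
Proof.
rewrite normrM -[leRHS]mul1r ler_pM ?cos_max//.
elim: cs => [|c cs IH]; first by rewrite big_nil normr1.
rewrite big_cons normrM exprS ler_pM// (le_trans (ler_normD _ _))// normr1.
have := cos_max (L * t + th + c); lra.
Qed.

Lemma integrable_harmonic_prod th m d cs :
  mu.-integrable setT (EFin \o (fun t => F t * harmonic_prod L th m d cs t)).
Proof.
apply: (integrableM_bounded intF (measurable_harmonic_prod th m d cs)).
exact: harmonic_prod_max.
Qed.

(** Expanding one factor by product-to-sum keeps [m] or moves it by 1 either way, so the induction
    runs over all [m] and [d]. Once no factor is left, the integrand is free of [th] if [m = 0], and
    otherwise its frequency is too high for [F] and the integral vanishes. *)
Lemma Rintegral_harmonic_prod th m d cs :
  \int[mu]_t (F t * harmonic_prod L th m d cs t) =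
  \int[mu]_t (F t * harmonic_prod L 0 m d cs t).
Proof.
elim: cs m d => [|c cs IH] m d.
  have [->|m0] := eqVneq m 0.
    by apply: eq_Rintegral => t _; rewrite /harmonic_prod !mul0r !big_nil.
  suff vanish th' : \int[mu]_t (F t * harmonic_prod L th' m d [::] t) = 0.
    by rewrite !vanish.
  have mL : s + 1 <= `|m%:~R| * L.
    have L0 : 0 <= L by rewrite (le_trans _ sL)// addr_ge0.
    rewrite (le_trans sL)// ler_peMl//.
    by rewrite -intr_norm ler1z -gtz0_ge1 normr_gt0.
  (* Only positive frequencies are covered by [bandlimited]; for negative [m] the evenness of the
     cosine moves the sign into the phase. *)
  rewrite -(bandlimited_integral (Num.sg m%:~R * (m%:~R * th' + d)) bF intF mL).
  apply: eq_Rintegral => t _; rewrite /harmonic_prod big_nil mulr1.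
  congr (_ * _).
  rewrite normrEsg -!mulrA -mulrDr cos_sg ?intr_eq0//.
  by congr cos; ring.
have expand th' t : F t * harmonic_prod L th' m d (c :: cs) t =
    F t * harmonic_prod L th' m d cs t +
    (2^-1 * (F t * harmonic_prod L th' (m + 1) (d + c) cs t) +
     2^-1 * (F t * harmonic_prod L th' (m - 1) (d - c) cs t)).
  rewrite /harmonic_prod big_cons; set P := \prod_(_ <- _) _.
  rewrite !rmorphD rmorphN rmorph1.
  set y := L * t + th'.
  rewrite (_ : (m%:~R + 1) * y + (d + c) = (m%:~R * y + d) + (y + c)); last by ring.
  rewrite (_ : (m%:~R - 1) * y + (d - c) = (m%:~R * y + d) - (y + c)); last by ring.
  move: (_ * y + d) (y + c) => a b.
  by rewrite cosD cosB; field.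
have expand_int th' : \int[mu]_t (F t * harmonic_prod L th' m d (c :: cs) t) =
    \int[mu]_t (F t * harmonic_prod L th' m d cs t) +
    (2^-1 * \int[mu]_t (F t * harmonic_prod L th' (m + 1) (d + c) cs t) +
     2^-1 * \int[mu]_t (F t * harmonic_prod L th' (m - 1) (d - c) cs t)).
  under eq_Rintegral do rewrite expand.
  have intZ m' d' : mu.-integrable setT (EFin \o (fun t =>
      2^-1 * (F t * harmonic_prod L th' m' d' cs t))).
    have := @integrableZl _ _ _ mu setT measurableT 2^-1 _
      (integrable_harmonic_prod th' m' d' cs).
    exact.
  have intD : mu.-integrable setT (EFin \o (fun t =>
     2^-1 * (F t * harmonic_prod L th' (m + 1) (d + c) cs t) +
     2^-1 * (F t * harmonic_prod L th' (m - 1) (d - c) cs t))).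
    have := @integrableD _ _ _ mu setT measurableT _ _
      (intZ (m + 1) (d + c)) (intZ (m - 1) (d - c)).
    exact.
  rewrite RintegralD//; last exact: integrable_harmonic_prod.
  by rewrite RintegralD// !RintegralZl//; exact: integrable_harmonic_prod.
by rewrite !expand_int !IH.
Qed.

End phase.

(** * The modulated family and its decks *)

Definition modulated_sinc (L th t : R) : R := sinc t ^+ 2 * (1 + cos (L * t + th)).

Lemma modulated_sinc_ge0 L th t : 0 <= modulated_sinc L th t.
Proof. by rewrite mulr_ge0 ?sqr_ge0// -lerBlDl sub0r cos_geN1. Qed.

Lemma nonneg_L1_modulated_sinc L th : nonneg_L1 (modulated_sinc L th).
Proof.
split; last exact: modulated_sinc_ge0.
apply: (integrableM_bounded (M := 2) integrable_sinc_sqr).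
  by apply: measurable_funD; [exact: measurable_cst|exact: measurable_cos_affine].
move=> t; rewrite (le_trans (ler_normD _ _))// normr1.
have := cos_max (L * t + th); lra.
Qed.

(** The [k] squared factors have bandwidth 2 each, and [L] exceeds the total [2 * k] by at least 1.
    Boundedness of [sinc] makes the deck finite at every [x], so equality holds everywhere. *)
Lemma kdeck_modulated_sinc k L th (x : k.-1.-tuple (measurableTypeR R)) :
  (0 < k)%N -> (k.*2.+1)%:R <= L ->
  kdeck (modulated_sinc L th) x = kdeck (modulated_sinc L 0) x.
Proof.
move=> k0 kL.
pose F (t : R) := sinc t ^+ 2 * \prod_(y <- (x : seq R)) sinc (t + y) ^+ 2.
have b2 : bandlimited 2 (fun t : R => sinc t ^+ 2).
  have := bandlimited_prod_sinc [:: 0] bandlimited1.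
  rewrite /= add0r; congr bandlimited; apply/funext => t.
  by rewrite big_seq1 addr0 mul1r.
have bF : bandlimited (k.*2)%:R F.
  have := bandlimited_prod_sinc (x : seq R) b2.
  by rewrite size_tuple -mulrnA -natrD muln2 add2n -doubleS prednK.
have intF : mu.-integrable setT (EFin \o F).
  have [mF F1 _] := bF.
  apply: (integrableM_bounded (M := 1) integrable_sinc_sqr).
    apply: measurable_prod => y _; apply: measurable_funX.
    apply: (measurableT_comp measurable_sinc).
    by apply: measurable_funD => //; exact: measurable_cst.
  move=> t; elim: (x : seq R) => [|y ys IH]; first by rewrite big_nil normr1.
  by rewrite big_cons normrM normrX mulr_ile1 ?exprn_ile1 ?sinc_max.
have sL : (k.*2)%:R + 1 <= L by rewrite natr1.
(* The head 0 is the phase shift of the untranslated factor; translating by [y] shifts the phase by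
   [L * y]. *)
pose cs : seq R := 0 :: [seq L * y | y <- (x : seq R)].
have deckE th' : kdeck (modulated_sinc L th') x =
    (\int[mu]_t (F t * harmonic_prod L th' 0 0 cs t))%:E.
  rewrite /Rintegral fineK; last first.
    have := @integrable_fin_num _ _ _ mu setT measurableT _
      (integrable_harmonic_prod L intF th' 0 0 cs).
    exact.
  apply: eq_integral => t _; congr EFin.
  rewrite -(big_tuple _ _ x xpredT (fun y => modulated_sinc L th' (t + y))).
  rewrite /harmonic_prod mul0r add0r cos0 mul1r big_cons big_map addr0.
  rewrite /F /modulated_sinc big_split/= mulrACA; congr (_ * (_ * _)).
  by apply: eq_bigr => y _; congr (1 + cos _); ring.
by rewrite !deckE (Rintegral_harmonic_prod intF bF _ sL).
Qed.

(** * Translates within the family, and its uncountability *)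

Lemma continuous_ae_eq0 f : continuous f -> {ae mu, forall t, f t = 0} ->
  forall t, f t = 0.
Proof.
move=> cf f0 t; apply/eqP; apply: contraT => ft0.
have : \forall y \near t, f y != 0 by exact: cvgr_neq0 (f t) (cf t) ft0.
move=> /nbhs_ballP[e /= e0 te].
have : mu.-negligible (ball t e) by apply: negligibleS f0 => y /te /eqP.
move/(negligibleP mu (measurable_ball t e)).1 => ball0.
have : (e *+ 2)%:E = 0%:E by rewrite -(lebesgue_measure_ball t (ltW e0)).
by move=> [/eqP]; rewrite mulrn_eq0/= gt_eqF.
Qed.

(** This is [t ^ 2] times the family member. The frequency is a natural number so that [pi *+ 2] is
    a period of both factors. *)
Definition phase_profile (l : nat) (th t : R) : R :=
  sin t ^+ 2 * (1 + cos (l%:R * t + th)).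

Lemma modulated_sinc_sqr l th t :
  modulated_sinc l%:R th t * t ^+ 2 = phase_profile l th t.
Proof. by rewrite /modulated_sinc mulrAC -exprMn sincM. Qed.

Lemma phase_profileD2pi l th : periodic (phase_profile l th) (pi *+ 2).
Proof.
move=> t; rewrite /phase_profile sinD2pi [l%:R * _]mulrDr addrAC.
by rewrite [l%:R * (pi *+ 2)]mulr_natl (periodicn (@cosD2pi R)).
Qed.

Lemma continuous_phase_profile l th : continuous (phase_profile l th).
Proof.
move=> t; apply: cvgM; first by apply: cvgM; exact: continuous_sin.
by apply: cvgD; [exact: cvg_cst|exact: continuous_cos_affine].
Qed.

Lemma translates_modulated_sinc_inj (l : nat) (th1 th2 : R) : (0 < l)%N ->
  0 < th1 <= 1 -> 0 < th2 <= 1 ->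
  translates (modulated_sinc l%:R th1) (modulated_sinc l%:R th2) -> th1 = th2.
Proof.
move=> l0 /andP[th1_gt0 th1_le1] /andP[th2_gt0 th2_le1] [a ae_eq].
pose P := phase_profile l.
(* Multiplying by both squares avoids the singular points 0 and [a]; continuity then removes the
   exceptional null set. *)
have profile_eq t : (t - a) ^+ 2 * P th2 t = t ^+ 2 * P th1 (t - a).
  apply/eqP; rewrite -subr_eq0; apply/eqP; move: t; apply: continuous_ae_eq0.
    move=> t; have csub : continuous (fun t : R => t - a).
      by move=> y; apply: cvgB; [exact: cvg_id|exact: cvg_cst].
    apply: cvgB; apply: cvgM.
    - by apply: cvgM; exact: csub.
    - exact: continuous_phase_profile.
    - by apply: cvgM; exact: cvg_id.
    - apply: (@continuous_comp _ _ _ (fun t : R => t - a)); first exact: csub.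
      exact: continuous_phase_profile.
  apply: negligibleS ae_eq => t /= neq eqt; apply: neq.
  by rewrite -[P th2 t]modulated_sinc_sqr -[P th1 _]modulated_sinc_sqr eqt; ring.
have l_gt0 : 0 < l%:R :> R by rewrite ltr0n.
have l_ge1 : 1 <= l%:R :> R by rewrite ler1n.
(* At this point the cosine of phase [th2] equals 1. Since [0 < th2 <= 1], the sine is nonzero
   there, and so is [P th2 t0]. *)
pose t0 := - (th2 / l%:R).
have sin_t0 : sin t0 != 0.
  rewrite sinN oppr_eq0 gt_eqF// sin2_gt0// divr_gt0//= ltr_pdivrMr//.
  by rewrite (le_lt_trans th2_le1)//; lra.
have lt0 : l%:R * t0 = - th2 by rewrite mulrN mulrCA divff ?mulr1// gt_eqF.
have p_neq0 : P th2 t0 != 0.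
  by rewrite /P /phase_profile lt0 addNr cos0 mulf_neq0 ?expf_neq0//.
have c_gt0 : 0 < pi *+ 2 :> R by rewrite mulrn_wgt0 ?pi_gt0.
have := profile_eq t0; have := profile_eq (t0 + pi *+ 2).
have := profile_eq (t0 + pi *+ 2 + pi *+ 2).
have PD th t : P th (t + pi *+ 2) = P th t by exact: phase_profileD2pi.
have PDa th t : P th (t + pi *+ 2 - a) = P th (t - a) by rewrite addrAC PD.
rewrite !PDa !PD.
have [p pE] : exists p, p = P th2 t0 by exists (P th2 t0).
have [q qE] : exists q, q = P th1 (t0 - a) by exists (P th1 (t0 - a)).
rewrite -pE -qE in p_neq0 *.
move: (pi *+ 2) c_gt0 => c c_gt0 e2 e1 e0.
(* The relation says [(t0 + n c - a)^2 p = (t0 + n c)^2 q] for n = 0, 1, 2. Its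
   second difference in n gives [p = q], and then the first gives [a = 0]. *)
have pq : p = q.
  have : (c ^+ 2 *+ 2) * (p - q) = 0.
    have -> : (c ^+ 2 *+ 2) * (p - q) =
      ((t0 + c + c - a) ^+ 2 * p - (t0 + c + c) ^+ 2 * q) -
      2 * ((t0 + c - a) ^+ 2 * p - (t0 + c) ^+ 2 * q) +
      ((t0 - a) ^+ 2 * p - t0 ^+ 2 * q) by ring.
    by rewrite e0 e1 e2; ring.
  move/eqP; rewrite mulf_eq0 mulrn_eq0/= sqrf_eq0 (gt_eqF c_gt0)/= subr_eq0.
  by move/eqP.
have a0 : a = 0.
  have : (2 * c * p) * a = 0.
    have -> : (2 * c * p) * a =
      ((t0 - a) ^+ 2 * p - t0 ^+ 2 * p) -
      ((t0 + c - a) ^+ 2 * p - (t0 + c) ^+ 2 * p) by ring.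
    by rewrite e0 e1 -pq; ring.
  move/eqP; rewrite !mulf_eq0 (gt_eqF c_gt0) (negPf p_neq0) pnatr_eq0/=.
  by move/eqP.
move: pq; rewrite pE qE a0 subr0 /P /phase_profile lt0 addNr cos0.
move=> /(mulfI (expf_neq0 2 sin_t0)) /addrI cos1.
(* The cosine of [th1 - th2] is 1, and it is injective on [[0, pi]], where the absolute value lies
   because both phases are in []0, 1]]. *)
have : `|th1 - th2| = 0.
  apply: cos_inj; rewrite ?in_itv/= ?lexx ?pi_ge0//.
    rewrite normr_ge0/= (le_trans _ (pi_ge2 R))// ler_norml; lra.
  by rewrite cos_norm cos0 cos1 addrC.
by move/normr0_eq0/subr0_eq.
Qed.

(** Equal functions are translates by 0, so the phase is determined by the function; and []0, 1]]
    has measure 1, while countable sets are null. *)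
Lemma uncountable_modulated_sinc (l : nat) : (0 < l)%N ->
  ~ countable [set modulated_sinc l%:R th | th in `]0%R, 1%R]%classic : set R].
Proof.
move=> l0 countS.
have inj : {in (`]0%R, 1%R]%classic : set R) &, injective (modulated_sinc l%:R)}.
  move=> th1 th2; rewrite !inE/= !in_itv/= => th1P th2P eqth.
  apply: (translates_modulated_sinc_inj l0 th1P th2P).
  by exists 0; apply: aeW => x; rewrite subr0 eqth.
have count01 : countable (`]0%R, 1%R]%classic : set R).
  by rewrite -(eq_countable (inj_card_eq inj)).
have := countable_lebesgue_measure0 count01.
rewrite lebesgue_measure_itv/= lte_fin ltr01 oppr0 adde0 => -[/eqP].
by rewrite oner_eq0.
Qed.

End deck_invariance.

Theorem proposition2p5 (R : realType) (k : nat) (hk : (3 <= k)%N) :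
  exists f : R -> R, nonneg_L1 f /\
    exists S : set (R -> R),
      [/\ ~ countable S,
          forall g, S g -> nonneg_L1 g,
          forall g, S g -> same_kdeck k g f &
          forall g h, S g -> S h -> g <> h -> ~ translates g h].
Proof.
(* The frequency is the bandwidth [2 * k] plus the gap 1 required in [bandlimited]. The reference
   phase 0 lies outside []0, 1]], but its deck is the common one. *)
exists (modulated_sinc (k.*2.+1)%:R 0); split; first exact: nonneg_L1_modulated_sinc.
exists [set modulated_sinc (k.*2.+1)%:R th | th in `]0%R, 1%R]%classic].
split=> [|_ [th _ <-]|_ [th _ <-]|_ _ [th1 th1P <-] [th2 th2P <-] neq tr].
- exact: uncountable_modulated_sinc.
- exact: nonneg_L1_modulated_sinc.
- by apply: aeW => x; apply: kdeck_modulated_sinc => //; exact: ltn_trans hk.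
- rewrite /= in_itv/= in th1P; rewrite /= in_itv/= in th2P.
  by apply: neq; rewrite (translates_modulated_sinc_inj _ th1P th2P tr).
Qed.
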